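(* Let $H$ be a commutative Poisson algebra with trivial ring structure (i.e. $ab=0$ for all $a,b\in H$) such that $Z(H)=\{0\}$, and let $K$ be a commutative Poisson algebra. Then the map $\Phi$ from $RExt(H,K)$ to the set $Hom(K,OutDer(H))$, given by $\Phi([\mathcal{E}])=\Gamma_{\mathcal{E}}$, is bijective. More explicitly, every abstract kernel $\eta$ of $K$ to $H$ is uniquely determined by an equivalence class of extensions in $RExt(H,K)$.
   Context: All vector spaces are over a fixed field $\mathbb{F}$. A commutative Poisson algebra is a vector space $P$ with bilinear operations $\cdot$ and $[\ ,\ ]$ such that $(P,\cdot)$ is a commutative associative $\mathbb{F}$-algebra (no unit required), $(P,[\ ,\ ])$ is a Lie algebra (with $[x,x]=0$ and Jacobi identity), and $[x\cdot y,z]=[x,z]\cdot y+x\cdot[y,z]$. Poisson algebra homomorphisms are linear maps preserving both operations. The Poisson center is $Z(P)=\{x\in P: xy=[x,y]=0\ \forall y\in P\}$ and the ring center is $Z_R(P)=\{x\in P: xy=0\ \forall y\in P\}$. $Der(H)$ is the space of Poisson derivations of $H$ (linear $D$ with $D(ab)=D(a)b+aD(b)$, $D([a,b])=[D(a),b]+[a,D(b)]$), regarded as a commutative Poisson algebra with the commutator bracket and the trivial (zero) product. $IDer(H)=\{ad_a: a\in H\}$, where $ad_a(b)=[a,b]$; it is an ideal of $Der(H)$ when $H$ has trivial ring structure, and $OutDer(H)=Der(H)/IDer(H)$ (again with zero product). $Hom(K,OutDer(H))$ is the set of Poisson algebra homomorphisms $K\to OutDer(H)$, called abstract kernels (couplings)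 of $K$ to $H$. A ring center extension of $H$ (with trivial ring structure) by $K$ is a short exact sequence $\mathcal{E}\equiv 0\to H\xrightarrow{i}P\xrightarrow{\beta}K\to0$ of commutative Poisson algebras with $i(H)\subseteq Z_R(P)$; $H$ is identified with $i(H)$. Two such, with middle terms $P,P'$, are equivalent if there is a Poisson algebra isomorphism $\phi:P\to P'$ inducing the identity on $H$ and on $K$. $RExt(H,K)$ is the set of equivalence classes. A section of $\mathcal{E}$ is a linear map $t:K\to P$ with $\beta\circ t=I_K$; put $\Gamma^t_x(a)=[t(x),a]$ for $x\in K$, $a\in H$. The abstract kernel $\Gamma_{\mathcal{E}}:K\to OutDer(H)$, $\Gamma_{\mathcal{E}}(x)=\Gamma^t_x+IDer(H)$, depends only on the equivalence class of $\mathcal{E}$ (not on $t$). *)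

(* Defs.v *)
From HB Require Import structures.
From mathcomp Require Import all_boot all_algebra ssrAC.
From mathcomp Require Import boolp classical_sets functions.

Set Implicit Arguments.
Unset Strict Implicit.
Unset Printing Implicit Defensive.

Import GRing.Theory.
Local Open Scope ring_scope.
Local Open Scope classical_set_scope.
Local Open Scope quotient_scope.

(* MathComp rings are unital, so the possibly non-unital product of a Poisson
   algebra is not inherited from the ring hierarchy. *)
HB.mixin Record isPoissonAlg (F : fieldType) (P : Type) of GRing.Lmodule F P := {
  pmul : P -> P -> P;
  pbr : P -> P -> P;
  pmul_linearl : forall y, linear (pmul^~ y);
  pmul_linearr : forall x, linear (pmul x);
  pmulC : commutative pmul;
  pmulA : associative pmul;
  pbr_linearl : forall y, linear (pbr^~ y);
  pbr_linearr : forall x, linear (pbr x);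
  pbrxx : forall x, pbr x x = 0;
  pbr_jacobi : forall x y z,
    pbr x (pbr y z) + pbr y (pbr z x) + pbr z (pbr x y) = 0;
  pbr_leibniz : forall x y z,
    pbr (pmul x y) z = pmul (pbr x z) y + pmul x (pbr y z)
}.

#[short(type="poissonAlgType")]
HB.structure Definition PoissonAlg (F : fieldType) :=
  {P of GRing.Lmodule F P & isPoissonAlg F P}.

Declare Scope poisson_scope.
Delimit Scope poisson_scope with Poisson.
Local Open Scope poisson_scope.

Notation "x ** y" := (pmul x y) (at level 40, left associativity)
  : poisson_scope.
Notation "{[ x , y ]}" := (pbr x y) (at level 0, x at level 99, y at level 99,
  format "{[ x ,  y ]}") : poisson_scope.

HB.mixin Record isPoissonMorphism (F : fieldType) (P Q : poissonAlgType F)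
    (f : P -> Q) := {
  pmorphM : {morph f : x y / x ** y};
  pmorphB : {morph f : x y / {[x, y]}}
}.

HB.structure Definition PoissonMorphism (F : fieldType)
    (P Q : poissonAlgType F) :=
  {f of isPoissonMorphism F P Q f & @GRing.Linear F P Q *:%R f}.

Notation "{ 'poisson' P -> Q }" := (PoissonMorphism.type P%type Q%type)
  (at level 0, P at level 98, Q at level 99,
   format "{ 'poisson'  P  ->  Q }") : type_scope.

Section PoissonTheory.
Variables (F : fieldType) (P : poissonAlgType F).
Implicit Types x y z : P.

HB.instance Definition _ x :=
  GRing.isLinear.Build F P P *:%R (pmul x) (pmul_linearr x).
HB.instance Definition _ x :=
  GRing.isLinear.Build F P P *:%R (pbr x) (pbr_linearr x).

Lemma pmul0r y : (0 : P) ** y = 0.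
Proof. by rewrite pmulC linear0. Qed.

Lemma pmulr0 y : y ** (0 : P) = 0.
Proof. by rewrite linear0. Qed.

Lemma pbrDl x y z : {[x + y, z]} = {[x, z]} + {[y, z]}.
Proof. by have := pbr_linearl z 1 x y; rewrite !scale1r. Qed.

Lemma pbr0l z : {[(0 : P), z]} = 0.
Proof. by apply: (addIr {[(0 : P), z]}); rewrite -pbrDl !add0r. Qed.

Lemma pbrZl c x z : {[c *: x, z]} = c *: {[x, z]}.
Proof. by have := pbr_linearl z c x 0; rewrite !addr0 pbr0l addr0. Qed.

Lemma pbrNl x z : {[- x, z]} = - {[x, z]}.
Proof. by rewrite -scaleN1r pbrZl scaleN1r. Qed.

Lemma pbrC x y : {[x, y]} = - {[y, x]}.
Proof.
apply/eqP; rewrite -addr_eq0; have := pbrxx (x + y).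
by rewrite pbrDl !linearD /= !pbrxx addr0 add0r => /eqP.
Qed.

Lemma pbr_jacobi' x y z :
  {[{[x, y]}, z]} = {[x, {[y, z]}]} - {[y, {[x, z]}]}.
Proof.
have := pbr_jacobi x y z; rewrite (pbrC z x) (pbrC z {[x, y]}) linearN /=.
by move=> /eqP; rewrite subr_eq0 => /eqP.
Qed.

Definition poisson_center : set P :=
  [set x | forall y, x ** y = 0 /\ {[x, y]} = 0].

Definition ring_center : set P := [set x | forall y, x ** y = 0].

End PoissonTheory.
Arguments poisson_center {F} P.
Arguments ring_center {F} P.

Section ZmodIdentities.
Variable V : zmodType.
Implicit Types a b c d e f : V.

Lemma commutator_leibniz_identity a b c d e f :
  (a + b + (c + d)) + (- (e + c) - (b + f)) = (a - e) + (d - f).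
Proof.
rewrite !opprD !addrA [LHS](ACl ((1*5)*4*8*(2*7)*(3*6)))%AC /=.
by rewrite !subrr !addr0.
Qed.

Lemma commutator_jacobi_identity a b c d e f :
  a - b + (- c - - d) + (c - e + (- f - - b)) + (f - d + (- a - - e)) = 0.
Proof.
rewrite !opprK !addrA.
rewrite [LHS](ACl ((1*11)*(8*2)*(4*10)*(5*3)*(12*6)*(9*7)))%AC /=.
by rewrite !subrr !addr0.
Qed.

End ZmodIdentities.

Section Derivations.
Variables (F : fieldType) (H : poissonAlgType F).

Definition is_derivation (D : H -> H) : Prop :=
  [/\ linear D,
      forall a b, D (a ** b) = D a ** b + a ** D b &
      forall a b, D {[a, b]} = {[D a, b]} + {[a, D b]}].

Definition derivation : {pred H -> H} := fun D => `[< is_derivation D >].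

Lemma derivation_submod_closed : subsemimod_closed derivation.
Proof.
split; first split.
- apply/asboolP; split=> [c a b|a b|a b] /=; first by rewrite scaler0 addr0.
  + by rewrite pmul0r pmulr0 addr0.
  + by rewrite pbr0l linear0 addr0.
- move=> D E /asboolP[Dl DM DB] /asboolP[El EM EB]; apply/asboolP.
  split=> [c a b|a b|a b]; rewrite !addrfctE.
  + by rewrite Dl El scalerDr addrACA.
  + by rewrite DM EM (pmulC (_ + _)) !linearD /= !(pmulC b) addrACA.
  + by rewrite DB EB pbrDl linearD addrACA.
- move=> c D /asboolP[Dl DM DB]; apply/asboolP.
  split=> [k a b|a b|a b]; rewrite !scalrfctE.
  + by rewrite Dl scalerDr !scalerA mulrC.
  + by rewrite DM (pmulC (_ *: _)) !linearZ /= -scalerDr (pmulC b).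
  + by rewrite DB pbrZl linearZ /= scalerDr.
Qed.

HB.instance Definition _ :=
  GRing.isSubmodClosed.Build F (H -> H) derivation derivation_submod_closed.

Record Der := MkDer { der_val :> H -> H; der_valP : der_val \in derivation }.

HB.instance Definition _ := [isSub for der_val].
HB.instance Definition _ := [Choice of Der by <:].
HB.instance Definition _ := [SubChoice_isSubLmodule of Der by <:].

Lemma derP (D : Der) : is_derivation D.
Proof. exact/asboolP/der_valP. Qed.

HB.instance Definition _ (D : Der) :=
  GRing.isLinear.Build F H H *:%R (der_val D) (let: And3 l _ _ := derP D in l).

Lemma der_ext (D E : Der) : D =1 E -> D = E.
Proof. by move=> DE; apply/val_inj/funext. Qed.

Lemma derM (D : Der) a b : D (a ** b) = D a ** b + a ** D b.
Proof. by case: (derP D). Qed.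

Lemma derB (D : Der) a b : D {[a, b]} = {[D a, b]} + {[a, D b]}.
Proof. by case: (derP D). Qed.

Lemma derDE (D E : Der) a : (D + E) a = D a + E a.
Proof. by []. Qed.

Lemma derNE (D : Der) a : (- D) a = - D a.
Proof. by []. Qed.

Lemma derZE c (D : Der) a : (c *: D) a = c *: D a.
Proof. by []. Qed.

Lemma der0E a : (0 : Der) a = 0.
Proof. by []. Qed.

Lemma der_commP (D E : Der) : (fun a => D (E a) - E (D a)) \in derivation.
Proof.
apply/asboolP; split=> [c a b|a b|a b].
- by rewrite !linearP /= addrACA scalerDr scalerN.
- rewrite !derM !linearD /= !derM (pmulC (_ - _)) !linearB /= !(pmulC b).
  by rewrite linearN /=; exact: commutator_leibniz_identity.
- rewrite !derB !linearD /= !derB pbrDl pbrNl linearN /=.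
  exact: commutator_leibniz_identity.
Qed.

Definition der_mul (D E : Der) : Der := 0.
Definition der_comm (D E : Der) : Der := MkDer (der_commP D E).

Lemma der_commE D E a : der_comm D E a = D (E a) - E (D a).
Proof. by []. Qed.

Lemma der_mul_linearl E : linear (der_mul^~ E).
Proof. by move=> c D D'; rewrite /der_mul /= scaler0 addr0. Qed.

Lemma der_mul_linearr D : linear (der_mul D).
Proof. by move=> c E E'; rewrite /der_mul scaler0 addr0. Qed.

Lemma der_comm_linearl E : linear (der_comm^~ E).
Proof.
move=> c D D'; apply: der_ext => a.
rewrite derDE derZE !der_commE !derDE !derZE linearP /=.
by rewrite scalerBr opprD addrACA.
Qed.

Lemma der_comm_linearr D : linear (der_comm D).
Proof.
move=> c E E'; apply: der_ext => a.
rewrite derDE derZE !der_commE !derDE !derZE linearP /=.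
by rewrite scalerBr opprD addrACA.
Qed.

Lemma der_commxx D : der_comm D D = 0.
Proof. by apply: der_ext => a; rewrite der_commE subrr. Qed.

Lemma der_comm_jacobi D E G :
  der_comm D (der_comm E G) + der_comm E (der_comm G D)
    + der_comm G (der_comm D E) = 0.
Proof.
apply: der_ext => a; rewrite !derDE !der_commE !linearB /=.
exact: commutator_jacobi_identity.
Qed.

Lemma der_comm_leibniz D E G :
  der_comm (der_mul D E) G = der_mul (der_comm D G) E + der_mul D (der_comm E G).
Proof.
by apply: der_ext => a; rewrite /der_mul addr0 der_commE !der0E linear0 subr0.
Qed.

HB.instance Definition _ := isPoissonAlg.Build F Der
  der_mul_linearl der_mul_linearr (fun _ _ => erefl) (fun _ _ _ => erefl)
  der_comm_linearl der_comm_linearr der_commxx der_comm_jacobi der_comm_leibniz.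

Lemma adP (a : H) : pbr a \in derivation.
Proof.
apply/asboolP; split=> [|b c|b c]; first exact: pbr_linearr.
- by rewrite pbrC pbr_leibniz opprD (pbrC b) (pbrC c) !linearN /= 
     (pmulC (- _)) linearN /= !opprK pmulC.
- by rewrite pbr_jacobi' addrNK.
Qed.

Definition ad (a : H) : Der := MkDer (adP a).

Lemma adE a b : ad a b = {[a, b]}.
Proof. by []. Qed.

Lemma ad_linear : linear ad.
Proof.
by move=> c a b; apply: der_ext => d; rewrite derDE derZE !adE pbrDl pbrZl.
Qed.

HB.instance Definition _ := GRing.isLinear.Build F H Der *:%R ad ad_linear.

Definition IDer : {pred Der} := fun D => `[< exists a, D = ad a >].

Lemma IDer_submod_closed : subsemimod_closed IDer.
Proof.
split; first split.
- by apply/asboolP; exists 0; rewrite linear0.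
- move=> D E /asboolP[a ->] /asboolP[b ->].
  by apply/asboolP; exists (a + b); rewrite linearD.
- move=> c D /asboolP[a ->]; apply/asboolP.
  by exists (c *: a); rewrite linearZ.
Qed.

HB.instance Definition _ :=
  GRing.isSubmodClosed.Build F Der IDer IDer_submod_closed.

Lemma IDer_idealr (D E : Der) : E \in IDer -> {[D, E]} \in IDer.
Proof.
move=> /asboolP[a ->]; apply/asboolP; exists (D a).
by apply: der_ext => b; rewrite der_commE !adE derB addrK.
Qed.

Lemma IDer_ideall (D E : Der) : D \in IDer -> {[D, E]} \in IDer.
Proof. by move=> DI; rewrite pbrC rpredN IDer_idealr. Qed.

Definition OutDer := Quotient.quot IDer.

HB.instance Definition _ := GRing.Zmodule.on OutDer.
HB.instance Definition _ := EqQuotient.on OutDer.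

Definition outder (D : Der) : OutDer := \pi_OutDer D.

Lemma outder_eq (D E : Der) : outder D = outder E <-> D - E \in IDer.
Proof.
rewrite /outder; split=> [/eqP|DE]; first by rewrite -Quotient.idealrBE.
by apply/eqP; rewrite -Quotient.idealrBE.
Qed.

Lemma outderK (u : OutDer) : outder (repr u) = u.
Proof. exact: reprK. Qed.

Lemma outderD D E : outder (D + E) = outder D + outder E.
Proof. by rewrite /outder !piE. Qed.

Definition outder_scale (c : F) (u : OutDer) : OutDer := outder (c *: repr u).

Lemma outder_scaleE c D : outder_scale c (outder D) = outder (c *: D).
Proof.
by apply/outder_eq; rewrite -scalerBr rpredZ//; apply/outder_eq/outderK.
Qed.

Lemma outder_scaleA a b u :
  outder_scale a (outder_scale b u) = outder_scale (a * b) u.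
Proof. by rewrite -(outderK u) !outder_scaleE scalerA. Qed.

Lemma outder_scale1 : left_id 1 outder_scale.
Proof. by move=> u; rewrite -(outderK u) outder_scaleE scale1r. Qed.

Lemma outder_scaleDr : right_distributive outder_scale +%R.
Proof.
move=> c u v; rewrite -(outderK u) -(outderK v) -outderD !outder_scaleE.
by rewrite scalerDr outderD.
Qed.

Lemma outder_scaleDl u : {morph outder_scale^~ u : a b / a + b}.
Proof.
by move=> a b /=; rewrite -(outderK u) !outder_scaleE scalerDl outderD.
Qed.

HB.instance Definition _ := GRing.Zmodule_isLmodule.Build F OutDer
  outder_scaleA outder_scale1 outder_scaleDr outder_scaleDl.

Lemma outder_linear : linear outder.
Proof. by move=> c D E; rewrite outderD -outder_scaleE. Qed.

HB.instance Definition _ :=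
  GRing.isLinear.Build F Der OutDer *:%R outder outder_linear.

Definition outder_mul (u v : OutDer) : OutDer := 0.
Definition outder_br (u v : OutDer) : OutDer := outder {[repr u, repr v]}.

Lemma outder_brE D E : outder_br (outder D) (outder E) = outder {[D, E]}.
Proof.
have eqD G := (outder_eq (repr (outder G)) G).1 (outderK _).
apply/outder_eq.
have -> : {[repr (outder D), repr (outder E)]} - {[D, E]} =
    {[repr (outder D) - D, repr (outder E)]} + {[D, repr (outder E) - E]}.
  by rewrite pbrDl pbrNl linearB /= addrA addrNK.
by apply: rpredD; [exact: IDer_ideall|exact: IDer_idealr].
Qed.

Lemma outder_mul_linearl v : linear (outder_mul^~ v).
Proof. by move=> c D D'; rewrite /outder_mul /= scaler0 addr0. Qed.

Lemma outder_mul_linearr u : linear (outder_mul u).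
Proof. by move=> c E E'; rewrite /outder_mul scaler0 addr0. Qed.

Lemma outder_br_linearl v : linear (outder_br^~ v).
Proof.
move=> c u u'; rewrite -(outderK u) -(outderK v) -(outderK u') /=.
by rewrite -linearP !outder_brE pbr_linearl linearP.
Qed.

Lemma outder_br_linearr u : linear (outder_br u).
Proof.
move=> c v v'; rewrite -(outderK u) -(outderK v) -(outderK v').
by rewrite -linearP !outder_brE !linearP.
Qed.

Lemma outder_brxx u : outder_br u u = 0.
Proof. by rewrite -(outderK u) outder_brE pbrxx linear0. Qed.

Lemma outder_br_jacobi u v w :
  outder_br u (outder_br v w) + outder_br v (outder_br w u)
    + outder_br w (outder_br u v) = 0.
Proof.
rewrite -(outderK u) -(outderK v) -(outderK w) !outder_brE.
by rewrite -!linearD pbr_jacobi linear0.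
Qed.

Lemma outder_br_leibniz u v w :
  outder_br (outder_mul u v) w =
  outder_mul (outder_br u w) v + outder_mul u (outder_br v w).
Proof.
rewrite /outder_mul addr0 -(outderK w) -[X in outder_br X](linear0 outder).
by rewrite outder_brE pbr0l linear0.
Qed.

HB.instance Definition _ := isPoissonAlg.Build F OutDer
  outder_mul_linearl outder_mul_linearr (fun _ _ => erefl) (fun _ _ _ => erefl)
  outder_br_linearl outder_br_linearr outder_brxx outder_br_jacobi
  outder_br_leibniz.

End Derivations.
Arguments Der {F} H.
Arguments IDer {F} H.
Arguments OutDer {F} H.

Section LinearSection.
Variables (F : fieldType) (P K : lmodType F) (f : {linear P -> K}).

Lemma linear_section_exists :
  (forall x, exists p, f p = x) -> exists t : {linear K -> P}, cancel t f.
Proof.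
move=> fsurj.
pose indep (S : set P) := (forall c p q, S p -> S q -> S (c *: p + q)) /\
  (forall p, S p -> f p = 0 -> p = 0).
have [A AP Atot|S [[Sl S0] Smax]] := @Zorn_bigcup P indep.
  split=> [c p q [X AX Xp] [Y AY Yq]|p [X AX Xp] fp0]; last first.
    by have [_] := AP _ AX; apply.
  have [XY|YX] := Atot _ _ AX AY.
    by exists Y => //; apply: (AP _ AY).1 => //; exact: XY.
  by exists X => //; apply: (AP _ AX).1 => //; exact: YX.
pose S' := [set p | S p \/ p = 0].
have Spl c p q : S' p -> S' q -> S' (c *: p + q).
  move=> [Sp|->] [Sq|->]; rewrite ?scaler0 ?add0r ?addr0.
  - by left; exact: Sl.
  - left; rewrite (_ : c *: p = (c - 1) *: p + p); first exact: Sl.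
    by rewrite scalerBl scale1r addrNK.
  - by left.
  - by right.
have Sp0 p : S' p -> f p = 0 -> p = 0 by move=> [/S0//|].
have SpZ c p : S' p -> S' (c *: p).
  by move=> S'p; rewrite -[_ *: _]addr0; apply: (Spl) => //; right.
have cover x : exists2 p, S' p & f p = x.
  apply: contrapT => nx; have [q fq] := fsurj x.
  pose T := [set p | exists s c, S' s /\ p = s + c *: q].
  apply: (Smax T); last first.
    split=> [c _ _ [s [d [S's ->]]] [s' [d' [S's' ->]]]|_ [s [c [S's ->]]]].
      exists (c *: s + s'), (c * d + d'); split; first exact: Spl.
      by rewrite scalerDr scalerA scalerDl addrACA.
    have [->|c0] := eqVneq c 0; first by rewrite scale0r addr0; exact: Sp0.
    rewrite linearD linearZ /= fq => /eqP; rewrite addrC addr_eq0 => /eqP cx.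
    exfalso; apply: nx; exists (- c^-1 *: s); first exact: SpZ.
    by rewrite linearZ /= scaleNr -scalerN -cx scalerA mulVf// scale1r.
  split=> [p Sp|/(_ q) TS].
    by exists p, 0; split; [left|rewrite scale0r addr0].
  apply: nx; exists q => //; left; apply: TS.
  by exists 0, 1; split; [right|rewrite scale1r add0r].
pose t x := sval (cid2 (cover x)).
have S't x : S' (t x) by rewrite /t; case: cid2.
have tK x : f (t x) = x by rewrite /t; case: cid2.
have tl : linear t.
  move=> c x y; apply/eqP; rewrite -subr_eq0; apply/eqP/Sp0.
    rewrite -[X in X - _]scale1r -scaleN1r; apply: (Spl) => //.
    by apply: (SpZ); apply: (Spl).
  by rewrite linearB linearP /= !tK subrr.
pose L := GRing.isLinear.Build F K P *:%R t tl.
pose t' : {linear K -> P} := HB.pack t L.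
by exists t'.
Qed.

End LinearSection.

Section PoissonHom.
Variables (F : fieldType) (P Q : poissonAlgType F).

Definition poisson_hom (f : P -> Q) (fl : linear f)
    (fM : {morph f : x y / x ** y}) (fB : {morph f : x y / {[x, y]}}) :
    {poisson P -> Q} :=
  HB.pack f (GRing.isLinear.Build F P Q *:%R f fl)
    (isPoissonMorphism.Build F P Q f fM fB).

Lemma poisson_hom_ext (f g : {poisson P -> Q}) : f =1 g -> f = g.
Proof.
case: f => f [[fm fb] [fa] [fs]]; case: g => g [[gm gb] [ga] [gs]] /= fg.
have {}fg : f = g by exact/funext.
case: g / fg gm gb ga gs => gm gb ga gs.
by rewrite (Prop_irrelevance fm gm) (Prop_irrelevance fb gb)
  (Prop_irrelevance fa ga) (Prop_irrelevance fs gs).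
Qed.

End PoissonHom.

Section Extensions.
Variables (F : fieldType) (H K : poissonAlgType F).

Record ring_center_ext := RingCenterExt {
  ext_mid : poissonAlgType F;
  ext_inj : {poisson H -> ext_mid};
  ext_prj : {poisson ext_mid -> K};
  ext_injP : injective ext_inj;
  ext_exact : range ext_inj = [set p | ext_prj p = 0];
  ext_prjP : range ext_prj = setT;
  ext_central : range ext_inj `<=` ring_center ext_mid
}.

Definition ext_equiv (E E' : ring_center_ext) : Prop :=
  exists phi : {poisson ext_mid E -> ext_mid E'},
    [/\ bijective phi,
        forall a, phi (ext_inj E a) = ext_inj E' a &
        forall p, ext_prj E' (phi p) = ext_prj E p].

Lemma ext_equiv_refl E : ext_equiv E E.
Proof.
have il : linear (@id (ext_mid E)) by [].
exists (@poisson_hom _ _ _ id il (fun _ _ => erefl) (fun _ _ => erefl)).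
by split=> //; exists id.
Qed.

Lemma ext_equiv_sym E E' : ext_equiv E E' -> ext_equiv E' E.
Proof.
move=> [phi [[psi phiK psiK] phii phip]].
have psil : linear psi.
  by move=> c x y; apply: (can_inj phiK); rewrite linearP /= !psiK.
have psiM : {morph psi : x y / x ** y}.
  by move=> x y; apply: (can_inj phiK); rewrite pmorphM !psiK.
have psiB : {morph psi : x y / {[x, y]}}.
  by move=> x y; apply: (can_inj phiK); rewrite pmorphB !psiK.
exists (poisson_hom psil psiM psiB); split=> [|a|p] /=.
- by exists phi.
- by rewrite -phii phiK.
- by rewrite -phip psiK.
Qed.

Lemma ext_equiv_trans E E' E'' :
  ext_equiv E E' -> ext_equiv E' E'' -> ext_equiv E E''.
Proof.
move=> [phi [bphi phii phip]] [psi [bpsi psii psip]].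
have cl : linear (psi \o phi) by move=> c x y /=; rewrite !linearP.
have cM : {morph psi \o phi : x y / x ** y}.
  by move=> x y /=; rewrite !pmorphM.
have cB : {morph psi \o phi : x y / {[x, y]}}.
  by move=> x y /=; rewrite !pmorphB.
exists (poisson_hom cl cM cB); split=> [|a|p] /=; first exact: bij_comp.
- by rewrite phii psii.
- by rewrite psip phip.
Qed.

(* ring_center_ext quantifies over all Poisson algebras, so it is too large for
   the universe of set; classes are plain predicates instead. *)
Definition ext_class (E : ring_center_ext) : ring_center_ext -> Prop :=
  fun E' => ext_equiv E E'.

Record RExt := MkRExt {
  rext_set :> ring_center_ext -> Prop;
  rext_setP : exists E, rext_set = ext_class E
}.

Definition rext_class (E : ring_center_ext) : RExt :=
  MkRExt (ex_intro _ E erefl).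

Lemma rext_classE E E' : rext_class E = rext_class E' <-> ext_equiv E E'.
Proof.
split=> [[EE']|EE'].
  have : ext_class E E by exact: ext_equiv_refl.
  by rewrite EE' => /ext_equiv_sym.
have eqc : ext_class E = ext_class E'.
  apply/funext => G; apply/propext; split; last exact: ext_equiv_trans.
  exact/ext_equiv_trans/ext_equiv_sym.
by rewrite /rext_class; move: (ex_intro _ _ _) (ex_intro _ _ _);
  rewrite eqc => p q; congr MkRExt; exact: Prop_irrelevance.
Qed.

Section AbstractKernel.
Variable E : ring_center_ext.
Local Notation P := (ext_mid E).
Local Notation i := (ext_inj E).

(* [p, a] for a in H, as an element of H identified with its image in P. *)
Definition ext_act (p : P) (a : H) : H := xget 0 [set b | i b = {[p, i a]}].

Lemma ext_actE p a : i (ext_act p a) = {[p, i a]}.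
Proof.
rewrite /ext_act; case: xgetP => [b _ //|no]; exfalso.
have : [set q | ext_prj E q = 0] {[p, i a]}.
  rewrite /= pmorphB (_ : ext_prj E (i a) = 0) ?linear0//.
  have : range i (i a) by exists a.
  by rewrite ext_exact.
by rewrite -ext_exact => -[b _ bE]; exact: (no b).
Qed.

Lemma ext_trivial (a b : H) : a ** b = 0.
Proof.
apply: (@ext_injP E); rewrite pmorphM linear0.
by apply: (@ext_central E); exists a.
Qed.

Lemma ext_act_derivation p : ext_act p \in @derivation F H.
Proof.
apply/asboolP; split=> [c a b|a b|a b]; apply: (@ext_injP E).
- by rewrite linearP /= !ext_actE !linearP.
- by rewrite !ext_trivial addr0 ext_actE !linear0.
- rewrite linearD /= !pmorphB !ext_actE pmorphB.
  by rewrite pbr_jacobi' addrNK.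
Qed.

Definition ext_der (p : P) : Der H := MkDer (ext_act_derivation p).

Lemma ext_der_linear : linear ext_der.
Proof.
move=> c p q; apply: der_ext => a; apply: (@ext_injP E).
rewrite derDE derZE linearP /= !ext_actE.
by rewrite pbr_linearl.
Qed.

Lemma ext_derB p q : ext_der {[p, q]} = {[ext_der p, ext_der q]}.
Proof.
apply: der_ext => a; apply: (@ext_injP E).
by rewrite der_commE linearB /= !ext_actE pbr_jacobi'.
Qed.

Lemma ext_derM p q : ext_der (p ** q) = 0.
Proof.
apply: der_ext => a; apply: (@ext_injP E).
have ic b r : i b ** r = 0 by apply: (@ext_central E); exists b.
by rewrite der0E linear0 /= ext_actE pbr_leibniz -!ext_actE ic pmulC ic addr0.
Qed.

Lemma ext_der_inj a : ext_der (i a) = ad a.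
Proof.
by apply: der_ext => b; apply: (@ext_injP E); rewrite /= ext_actE pmorphB.
Qed.

Definition is_section (t : {linear K -> P}) : Prop := cancel t (ext_prj E).

Definition Gamma (t : {linear K -> P}) (x : K) : Der H := ext_der (t x).

Lemma section_exists : exists t, is_section t.
Proof.
apply: linear_section_exists => x.
have : [set: K] x by [].
by rewrite -(@ext_prjP E) => -[p _ <-]; exists p.
Qed.

Definition ext_section : {linear K -> P} := sval (cid section_exists).

Lemma ext_sectionP : is_section ext_section.
Proof. exact: (svalP (cid section_exists)). Qed.

Lemma outder_ext_der (p q : P) :
  ext_prj E p = ext_prj E q -> outder (ext_der p) = outder (ext_der q).
Proof.
move=> pq; have : [set r | ext_prj E r = 0] (p - q).
  by rewrite /= linearB /= pq subrr.
rewrite -ext_exact => -[a _ apq].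
have -> : p = 1 *: i a + q by rewrite scale1r apq addrNK.
rewrite ext_der_linear scale1r ext_der_inj; apply/outder_eq.
by rewrite addrK; apply/asboolP; exists a.
Qed.

Definition kernel_fun (x : K) : OutDer H := outder (Gamma ext_section x).

Lemma kernel_funE p : kernel_fun (ext_prj E p) = outder (ext_der p).
Proof. by apply: outder_ext_der; rewrite ext_sectionP. Qed.

Lemma kernel_fun_linear : linear kernel_fun.
Proof.
by move=> c x y; rewrite /kernel_fun /Gamma linearP ext_der_linear linearP.
Qed.

Lemma kernel_funM : {morph kernel_fun : x y / x ** y}.
Proof.
move=> x y; rewrite -{1}(ext_sectionP x) -{1}(ext_sectionP y) -pmorphM.
by rewrite kernel_funE ext_derM linear0.
Qed.

Lemma kernel_funB : {morph kernel_fun : x y / {[x, y]}}.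
Proof.
move=> x y; rewrite -{1}(ext_sectionP x) -{1}(ext_sectionP y) -pmorphB.
by rewrite kernel_funE ext_derB -outder_brE.
Qed.

Definition abstract_kernel : {poisson K -> OutDer H} :=
  poisson_hom kernel_fun_linear kernel_funM kernel_funB.

Lemma abstract_kernelE t x :
  is_section t -> abstract_kernel x = outder (Gamma t x).
Proof. by move=> tE; apply: outder_ext_der; rewrite ext_sectionP tE. Qed.

End AbstractKernel.

Lemma abstract_kernel_equiv E E' :
  ext_equiv E E' -> abstract_kernel E = abstract_kernel E'.
Proof.
move=> [phi [_ phii phip]]; apply: poisson_hom_ext => x /=.
rewrite -{2}(ext_sectionP E x) -phip kernel_funE /kernel_fun /Gamma.
congr outder; apply: der_ext => a; apply: (@ext_injP E') => /=.
by rewrite ext_actE -!phii -pmorphB -ext_actE.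
Qed.

Definition rext_repr (C : RExt) : ring_center_ext := sval (cid (rext_setP C)).

Lemma rext_reprK C : rext_class (rext_repr C) = C.
Proof.
case: C => C CP; rewrite /rext_repr /=; case: cid => E /= CE.
by rewrite /rext_class; move: (ex_intro _ _ _); rewrite -CE => p;
  congr MkRExt; exact: Prop_irrelevance.
Qed.

Definition Phi (C : RExt) : {poisson K -> OutDer H} :=
  abstract_kernel (rext_repr C).

Lemma Phi_class E : Phi (rext_class E) = abstract_kernel E.
Proof.
by apply: abstract_kernel_equiv; apply/rext_classE; rewrite rext_reprK.
Qed.

End Extensions.
Arguments Phi {F} H K.

(* Main.v *)
Require Import Defs.
From HB Require Import structures.
From mathcomp Require Import all_boot all_algebra.
From mathcomp Require Import boolp classical_sets functions.

(** An extension [E] of [K] by [H] carries two Poisson homomorphisms, the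
    action [ext_der : P -> Der H] on the ideal [H] and the projection
    [P -> K]; by definition of the abstract kernel they agree in [OutDer H].
    They therefore induce a homomorphism from [P] to the pullback

      [Der H x_(OutDer H) K = {(D, x) | outder D = eta x}],

    where [eta] is the abstract kernel of [E].  Since [H] has zero product and
    zero center, [ad : H -> Der H] is injective with image [IDer H], the kernel
    of [outder].  Hence [P] and the pullback have the same kernel [H] and the
    same quotient [K], and the comparison map is an isomorphism, as in the
    five lemma ([ext_equiv_pullback]).  So [eta] determines the class of [E].

    Conversely, for every [eta] the pullback itself is a ring center extension
    of [K] by [H], because products in [Der H] vanish, and its action on [H] is
    the projection to [Der H], so its abstract kernel is [eta]
    ([pullback_ext_kernel]).  Thus the pullback is an explicit two-sided
    inverse of [Phi], and cocycles do not enter. *)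

Set Implicit Arguments.
Unset Strict Implicit.
Unset Printing Implicit Defensive.

Import GRing.Theory.
Local Open Scope ring_scope.
Local Open Scope classical_set_scope.
Local Open Scope poisson_scope.

(** * Pullbacks of Poisson algebras *)

Section Pullback.
Variables (F : fieldType) (A B C : poissonAlgType F).
Variables (f : {poisson A -> C}) (g : {poisson B -> C}).

Definition pullback_pred : {pred A * B} := fun p => f p.1 == g p.2.

Lemma pullback_submod_closed : subsemimod_closed pullback_pred.
Proof.
split; first split.
- by rewrite unfold_in /= !linear0.
- by move=> p q /eqP pP /eqP qP; rewrite unfold_in /= !linearD /= pP qP.
- by move=> c p /eqP pP; rewrite unfold_in /= !linearZ /= pP.
Qed.

HB.instance Definition _ :=
  GRing.isSubmodClosed.Build F (A * B)%type pullback_pred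
    pullback_submod_closed.

Record poisson_pullback := MkPullback {
  pb_val :> A * B;
  pb_valP : pb_val \in pullback_pred
}.

HB.instance Definition _ := [isSub for pb_val].
HB.instance Definition _ := [Choice of poisson_pullback by <:].
HB.instance Definition _ := [SubChoice_isSubLmodule of poisson_pullback by <:].

Implicit Types u v w : poisson_pullback.

Lemma pb_eq u : f u.1 = g u.2.
Proof. by apply/eqP; exact: pb_valP. Qed.

Lemma pb_ext u v : u.1 = v.1 -> u.2 = v.2 -> u = v.
Proof.
move=> uv1 uv2; apply: val_inj.
by rewrite [LHS]surjective_pairing [RHS]surjective_pairing /= uv1 uv2.
Qed.

Lemma pb_mul_subproof u v : (u.1 ** v.1, u.2 ** v.2) \in pullback_pred.
Proof. by rewrite unfold_in /= !pmorphM !pb_eq. Qed.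

Lemma pb_br_subproof u v : ({[u.1, v.1]}, {[u.2, v.2]}) \in pullback_pred.
Proof. by rewrite unfold_in /= !pmorphB !pb_eq. Qed.

Definition pb_mul u v := MkPullback (pb_mul_subproof u v).
Definition pb_br u v := MkPullback (pb_br_subproof u v).

Lemma pb_mul_linearl v : linear (pb_mul^~ v).
Proof. by move=> c u w; apply: pb_ext; exact: pmul_linearl. Qed.

Lemma pb_mul_linearr u : linear (pb_mul u).
Proof. by move=> c v w; apply: pb_ext; exact: pmul_linearr. Qed.

Lemma pb_mulC : commutative pb_mul.
Proof. by move=> u v; apply: pb_ext; exact: pmulC. Qed.

Lemma pb_mulA : associative pb_mul.
Proof. by move=> u v w; apply: pb_ext; exact: pmulA. Qed.

Lemma pb_br_linearl v : linear (pb_br^~ v).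
Proof. by move=> c u w; apply: pb_ext; exact: pbr_linearl. Qed.

Lemma pb_br_linearr u : linear (pb_br u).
Proof. by move=> c v w; apply: pb_ext; exact: pbr_linearr. Qed.

Lemma pb_brxx u : pb_br u u = 0.
Proof. by apply: pb_ext; exact: pbrxx. Qed.

Lemma pb_br_jacobi u v w :
  pb_br u (pb_br v w) + pb_br v (pb_br w u) + pb_br w (pb_br u v) = 0.
Proof. by apply: pb_ext; exact: pbr_jacobi. Qed.

Lemma pb_br_leibniz u v w :
  pb_br (pb_mul u v) w = pb_mul (pb_br u w) v + pb_mul u (pb_br v w).
Proof. by apply: pb_ext; exact: pbr_leibniz. Qed.

HB.instance Definition _ := isPoissonAlg.Build F poisson_pullback
  pb_mul_linearl pb_mul_linearr pb_mulC pb_mulA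
  pb_br_linearl pb_br_linearr pb_brxx pb_br_jacobi pb_br_leibniz.

Lemma pb_snd_linear : linear (fun u => u.2).
Proof. by []. Qed.

Definition pb_snd : {poisson poisson_pullback -> B} :=
  poisson_hom pb_snd_linear (fun _ _ => erefl) (fun _ _ => erefl).

(** [h] is a bare function with its morphism laws because that is the form in
    which [ad] and [ext_der] come. *)
Section Universal.
Variables (Q : poissonAlgType F) (h : Q -> A) (k : {poisson Q -> B}).
Hypotheses (hl : linear h) (hM : {morph h : x y / x ** y}).
Hypotheses (hB : {morph h : x y / {[x, y]}}).
Hypothesis hk : forall q, f (h q) = g (k q).

Lemma pb_pair_subproof q : (h q, k q) \in pullback_pred.
Proof. by rewrite unfold_in /= hk. Qed.

Definition pb_pair_fun q := MkPullback (pb_pair_subproof q).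

Lemma pb_pair_linear : linear pb_pair_fun.
Proof. by move=> c p q; apply: pb_ext; [exact: hl|exact: linearP]. Qed.

Lemma pb_pairM : {morph pb_pair_fun : x y / x ** y}.
Proof. by move=> p q; apply: pb_ext; [exact: hM|exact: pmorphM]. Qed.

Lemma pb_pairB : {morph pb_pair_fun : x y / {[x, y]}}.
Proof. by move=> p q; apply: pb_ext; [exact: hB|exact: pmorphB]. Qed.

Definition pb_pair : {poisson Q -> poisson_pullback} :=
  poisson_hom pb_pair_linear pb_pairM pb_pairB.

End Universal.
End Pullback.

(** * The derivation algebra of a centerless algebra with zero product *)

Section Centerless.
Variables (F : fieldType) (H K : poissonAlgType F).
Hypothesis H_trivial_ring : forall a b : H, a ** b = 0.
Hypothesis H_centerless : poisson_center H = [set 0].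

(** With zero product the Poisson center is exactly the kernel of [ad]. *)
Lemma ad_eq0 (a : H) : ad a = 0 -> a = 0.
Proof.
move=> a0; have : poisson_center H a.
  by move=> b; rewrite -adE a0 der0E H_trivial_ring.
by rewrite H_centerless.
Qed.

Lemma adM : {morph @ad F H : a b / a ** b}.
Proof. by move=> a b; rewrite H_trivial_ring linear0. Qed.

Lemma adB : {morph @ad F H : a b / {[a, b]}}.
Proof. by move=> a b; apply: der_ext => c; rewrite adE pbr_jacobi'. Qed.

Lemma outderM : {morph @outder F H : D E / D ** E}.
Proof. by move=> D E; exact: linear0. Qed.

Lemma outderB : {morph @outder F H : D E / {[D, E]}}.
Proof. by move=> D E; rewrite -outder_brE. Qed.

Definition outder_hom : {poisson Der H -> OutDer H} :=
  poisson_hom (@outder_linear F H) outderM outderB.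

Lemma outder_eq0 (D : Der H) : outder D = 0 <-> exists a, D = ad a.
Proof.
rewrite -(linear0 (@outder F H)) outder_eq subr0; split=> [/asboolP//|DI].
exact/asboolP.
Qed.

(** * The extension attached to an abstract kernel *)

Section Model.
Variable eta : {poisson K -> OutDer H}.
Local Notation PB := (poisson_pullback outder_hom eta).

Lemma zero_fun_linear : linear (fun _ : H => 0 : K).
Proof. by move=> c a b; rewrite scaler0 addr0. Qed.

Lemma zero_funM : {morph (fun _ : H => 0 : K) : a b / a ** b}.
Proof. by move=> a b; rewrite pmul0r. Qed.

Lemma zero_funB : {morph (fun _ : H => 0 : K) : a b / {[a, b]}}.
Proof. by move=> a b; rewrite pbr0l. Qed.

Definition zero_hom : {poisson H -> K} :=
  poisson_hom zero_fun_linear zero_funM zero_funB.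

Lemma ad_compat (a : H) : outder_hom (ad a) = eta (zero_hom a).
Proof. by rewrite linear0; apply/outder_eq0; exists a. Qed.

Definition pullback_inj : {poisson H -> PB} :=
  pb_pair (@ad_linear F H) adM adB ad_compat.

Lemma pullback_inj_inj : injective pullback_inj.
Proof.
move=> a b ab; apply/eqP; rewrite -subr_eq0; apply/eqP/ad_eq0.
have ab1 : (pullback_inj a : PB).1 = (pullback_inj b : PB).1 by rewrite ab.
by rewrite linearB /= [ad a]ab1 subrr.
Qed.

Lemma pullback_exact :
  range pullback_inj = [set u : PB | pb_snd outder_hom eta u = 0].
Proof.
apply/seteqP; split=> [_ [a _ <-]//|u /= u0].
have /outder_eq0[a ua] : outder u.1 = 0.
  by have /= -> := pb_eq u; rewrite [u.2]u0 linear0.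
by exists a => //; apply: pb_ext.
Qed.

Lemma pullback_surj : range (pb_snd outder_hom eta) = setT.
Proof.
apply/seteqP; split=> // x _.
have xP : (repr (eta x), x) \in pullback_pred outder_hom eta.
  by apply/eqP; exact: outderK.
by exists (MkPullback xP).
Qed.

(** Products vanish in [Der H] by definition and in [K] because the second
    component of [pullback_inj a] is 0. *)
Lemma pullback_central : range pullback_inj `<=` ring_center PB.
Proof.
by move=> _ [a _ <-] u; apply: pb_ext => //; exact: pmul0r.
Qed.

Definition pullback_ext : ring_center_ext H K :=
  RingCenterExt pullback_inj_inj pullback_exact pullback_surj pullback_central.

(** The first projection is the action on [H] because [{[D, ad a]} = ad (D a)],
    so that [(D, x)] sends [(ad a, 0)] to [(ad (D a), 0)]. *)
Lemma pullback_ext_der (u : ext_mid pullback_ext) :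
  ext_der u = (u : PB).1.
Proof.
apply: der_ext => a; apply: (@ext_injP _ _ _ pullback_ext).
rewrite ext_actE; apply: pb_ext => /=; last exact: linear0.
by apply: der_ext => b; rewrite der_commE !adE derB addrK.
Qed.

Lemma pullback_ext_kernel : abstract_kernel pullback_ext = eta.
Proof.
apply: poisson_hom_ext => x /=; rewrite /kernel_fun /Gamma pullback_ext_der.
have /= -> := pb_eq (ext_section pullback_ext x : PB).
by rewrite -[X in eta X]/(ext_prj pullback_ext _) ext_sectionP.
Qed.

End Model.

(** * Every extension is the pullback of its abstract kernel *)

Section Comparison.
Variable E : ring_center_ext H K.
Local Notation P := (ext_mid E).
Local Notation PB := (poisson_pullback outder_hom (abstract_kernel E)).

Lemma ext_der_compat (p : P) :
  outder_hom (ext_der p) = abstract_kernel E (ext_prj E p).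
Proof. exact/esym/kernel_funE. Qed.

(** The universal property applies because the abstract kernel of [E] is, by
    construction, the map that [outder \o ext_der] induces on [K]. *)
Definition pullback_cmp : {poisson P -> PB} :=
  pb_pair (@ext_der_linear _ _ _ E) (@ext_derM _ _ _ E) (@ext_derB _ _ _ E)
    ext_der_compat.

(** An element killed by the projection lies in [H], where [ext_der] restricts
    to the injective map [ad]. *)
Lemma pullback_cmp_inj : injective pullback_cmp.
Proof.
move=> p q pq; apply/eqP; rewrite -subr_eq0; apply/eqP.
have pqD : ext_der p = ext_der q := congr1 (fun u : PB => u.1) pq.
have pqK : ext_prj E p = ext_prj E q := congr1 (fun u : PB => u.2) pq.
have : [set r | ext_prj E r = 0] (p - q) by rewrite /= linearB /= pqK subrr.
rewrite -ext_exact => -[a _ apq]; rewrite -apq.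
suff /ad_eq0 -> : ad a = 0 by rewrite linear0.
rewrite -(ext_der_inj E) apq addrC -scaleN1r ext_der_linear pqD.
by rewrite scaleN1r addNr.
Qed.

Lemma pullback_cmp_surj (u : PB) : exists p, pullback_cmp p = u.
Proof.
have [p _ pu] : range (ext_prj E) u.2 by rewrite ext_prjP.
(* Two derivations over the same outer derivation differ by some [ad a];
   translating [p] by the image of [a] corrects the first component and leaves
   the second one fixed.  The coefficient 1 matches the form of [linear]. *)
have /outder_eq/asboolP[a ua] : outder u.1 = outder (ext_der p).
  by rewrite -kernel_funE pu; exact: pb_eq u.
exists (1 *: ext_inj E a + p); apply: pb_ext => /=.
  by rewrite ext_der_linear scale1r ext_der_inj -ua addrNK.
rewrite linearP /= pu scale1r.
have : range (ext_inj E) (ext_inj E a) by exists a.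
by rewrite ext_exact /= => ->; rewrite add0r.
Qed.

Lemma ext_equiv_pullback : ext_equiv E (pullback_ext (abstract_kernel E)).
Proof.
exists pullback_cmp; split=> // [|a].
  have [psi psiK] := choice pullback_cmp_surj.
  by exists psi => // p; apply: pullback_cmp_inj; rewrite psiK.
apply: pb_ext => /=; first exact: ext_der_inj.
have : range (ext_inj E) (ext_inj E a) by exists a.
by rewrite ext_exact.
Qed.

End Comparison.
End Centerless.

Theorem theorem4p8 (F : fieldType) (H K : poissonAlgType F)
    (H_trivial_ring : forall a b : H, a ** b = 0)
    (H_centerless : poisson_center H = [set 0]) :
  [/\ (* Phi([E]) = Gamma_E, computed with any linear section of E *)
      forall E : ring_center_ext H K,
        Phi H K (rext_class E) = abstract_kernel E /\
        forall (t : {linear K -> ext_mid E}), is_section t ->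
          forall x : K, abstract_kernel E x = outder (Gamma t x),
      bijective (Phi H K) &
      forall eta : {poisson K -> OutDer H},
        exists! C : RExt H K, Phi H K C = eta].
Proof.
pose model (eta : {poisson K -> OutDer H}) :=
  rext_class (pullback_ext H_trivial_ring H_centerless eta).
have modelK : cancel model (Phi H K).
  by move=> eta; rewrite Phi_class pullback_ext_kernel.
have PhiK : cancel (Phi H K) model.
  move=> C; rewrite -[RHS]rext_reprK; apply/esym/rext_classE.
  exact: ext_equiv_pullback.
split=> [E||eta].
- by split=> [|t tE x]; [exact: Phi_class|exact: abstract_kernelE].
- by exists model.
- by exists (model eta); split=> [|C <-]; [exact: modelK|exact: PhiK].
Qed.
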